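(* Fix $\alpha\in(0,1/2]$, an even number of blocks $B$, and a block length $H$ such that $\alpha H$ is an integer. Consider two arms with $\mu_1=1$ and $\mu_2=1-\Delta$, where $\Delta>0$. In odd blocks, require $m_{b,2}=\alpha H$ and $m_{b,1}=0$; in even blocks, require $m_{b,1}=m_{b,2}=0$. Then: (i) no single final-horizon global floor can encode these blockwise constraints, since an allocation may satisfy the exact aggregate count of arm $2$ while violating every odd-block requirement; (ii) any block-independent per-block lower bound $g_2H$ for arm $2$ either violates the odd-block requirement if $g_2<\alpha$, or, if $g_2\ge\alpha$, incurs at least $\frac{\alpha\Delta}{2}T$ additional blockwise regret relative to the best blockwise-fair comparator, where $T=BH$; and (iii) BDQ-UCB satisfies all blockwise constraints exactly and has regret $O(\sqrt{KR\log(KT)})$.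
   Context: Blockwise floors: the horizon $T=BH$ is partitioned into $B$ consecutive blocks of length $H$; $N_{b,i}$ is the number of pulls of arm $i$ in block $b$; the blockwise constraints are $N_{b,i}\ge m_{b,i}$ for all $b,i$. A final-horizon global floor constrains only the total pull counts of the arms over the whole horizon. A block-independent per-block lower bound $g_2H$ for arm $2$ imposes the same requirement of $g_2H$ pulls of arm $2$ in every block. Here $K=2$ is the number of arms. Arm $i$ produces independent rewards in $[0,1]$ with mean $\mu_i$; $\mu_\star=\max_i\mu_i$, $i^\star$ is a best arm, $\Delta_i=\mu_\star-\mu_i$. The best blockwise-fair comparator gives every arm its floor in each block and all remaining pulls to a best arm; its value is $\mathrm{OPT}_{\mathbf m}(T)=T\mu_\star-\sum_b\sum_{i\ne i^\star}m_{b,i}\Delta_i$, and the blockwise regret of a pull sequence $(A_t)$ is $\mathrm{OPT}_{\mathbf m}(T)-\sum_{t=1}^T\mu_{A_t}$. $R=\sum_b(H-\sum_im_{b,i})$ is the total number of nonmandatory rounds. BDQ-UCB (failure probability parameter $\eta\in(0,1)$, $L=\log(2KT/\eta)$): in each block $b$ first pull each arm $i$ exactly $m_{b,i}$ times, then in each remaining round of the block pull an arm maximizing $U_i$, where $U_i=+\infty$ if arm $i$ is unobserved and $U_i=\widehat\mu_i+\sqrt{2L/N_i}$ otherwise, with $N_i,\widehat\mu_i$ the total pull count and empirical mean of arm $i$ over all observations so far. *)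

(* Defs.v *)
From HB Require Import structures.
From mathcomp Require Import all_boot all_order all_algebra.
From mathcomp Require Import all_classical all_reals all_analysis.

Set Implicit Arguments.
Unset Strict Implicit.
Unset Printing Implicit Defensive.

Import Order.TTheory GRing.Theory Num.Theory.
Import numFieldNormedType.Exports.

Local Open Scope ring_scope.

(* Rounds and blocks are numbered from 0: block [b] consists of the rounds
   [b * H <= t < b.+1 * H], and the horizon is [T = B * H].  A pull sequence is
   a function [A : nat -> 'I_K]; only its values at [t < B * H] matter.
   The reward table [x : 'I_K -> nat -> R] gives at [x i n] the reward produced
   by the pull of arm [i] that has been preceded by [n] pulls of that arm. *)

Section Bandit.
Variables (R : realType) (K : nat).
Implicit Types (A : nat -> 'I_K) (m : nat -> 'I_K -> nat) (mu : 'I_K -> R).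
Implicit Types (x : 'I_K -> nat -> R) (B H b s t : nat) (i : 'I_K).

Definition pulls A i s t : nat := (\sum_(s <= u < t) (A u == i))%N.

Definition block_pulls H A b i : nat := pulls A i (b * H) (b.+1 * H).

Definition meets_blockwise B H m A : Prop :=
  forall b i, (b < B)%N -> (m b i <= block_pulls H A b i)%N.

Definition meets_global B H (G : 'I_K -> R) A : Prop :=
  forall i, G i <= (pulls A i 0 (B * H))%:R.

Definition meets_uniform B H i (g : R) A : Prop :=
  forall b, (b < B)%N -> g * H%:R <= (block_pulls H A b i)%:R.

Definition best_arm mu i : Prop := forall j, mu j <= mu i.

Definition opt B H m mu istar : R :=
  (B * H)%:R * mu istar
  - \sum_(b < B) \sum_(i < K | i != istar) (m b i)%:R * (mu istar - mu i).

Definition regret B H m mu istar A : R :=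
  opt B H m mu istar - \sum_(t < B * H) mu (A t).

(* Truncated subtraction: meaningful for floors with [\sum_i m b i <= H]. *)
Definition nonmandatory B H m : nat := (\sum_(b < B) (H - \sum_i m b i))%N.

Definition reward x A t : R := x (A t) (pulls A (A t) 0 t).

Definition emp_mean x A t i : R :=
  (\sum_(s < t | A s == i) reward x A s) / (pulls A i 0 t)%:R.

Definition log_term (T : nat) (eta : R) : R := ln (2 * K%:R * T%:R / eta).

Definition ucb_index (T : nat) (eta : R) x A t i : \bar R :=
  if pulls A i 0 t == 0%N then +oo%E
  else (emp_mean x A t i
        + Num.sqrt (2 * log_term T eta / (pulls A i 0 t)%:R))%:E.

(* A relation rather than a function: the order of the mandatory pulls inside a
   block and the tie-breaking between maximizers of the index are left free. *)
Definition bdq_ucb B H m (eta : R) x A : Prop :=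
  forall b, (b < B)%N ->
    let M := (b * H + \sum_j m b j)%N in
    (forall i, pulls A i (b * H) M = m b i) /\
    (forall t, (M <= t < b.+1 * H)%N ->
       forall j, (ucb_index (B * H) eta x A t j
                  <= ucb_index (B * H) eta x A t (A t))%E).

End Bandit.

Section Rewards.
Local Open Scope classical_set_scope.

Definition mutually_independent (R : realType) (d : measure_display)
    (Omega : measurableType d) (P : probability Omega R) (I : choiceType)
    (X : I -> {RV P >-> R}) : Prop :=
  forall (s : seq I) (E : I -> set R), uniq s ->
    (forall i, i \in s -> measurable (E i)) ->
    P (\bigcap_(i in [set` s]) (X i @^-1` E i))
    = (\prod_(i <- s) P (X i @^-1` E i))%E.

(* The rewards of an arm need not be identically distributed, and nothing is
   assumed about the dependence between different arms. *)
Definition bandit_rewards (R : realType) (K : nat) (d : measure_display)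
    (Omega : measurableType d) (P : probability Omega R)
    (mu : 'I_K -> R) (X : 'I_K -> nat -> {RV P >-> R}) : Prop :=
  forall i, [/\ mutually_independent (X i),
                forall n w, 0 <= X i n w <= 1
              & forall n, ('E_P[X i n] = (mu i)%:E)%E].

End Rewards.

Definition arm1 : 'I_2 := ord0.
Definition arm2 : 'I_2 := ord_max.

(* Counting blocks from 1, as is meant by odd and even blocks, the block with
   0-based index [b] is block number [b.+1]. *)
Definition odd_block (b : nat) : bool := odd b.+1.

Definition alternating_floor (a : nat) (b : nat) (i : 'I_2) : nat :=
  if odd_block b && (i == arm2) then a else 0%N.

(* Main.v *)
(** The regret of a schedule is [Delta] times the number of pulls of arm 2 beyond
    its floors, so (i) and (ii) are counting: moving the floor pulls from the odd
    to the even blocks leaves all totals unchanged, and a uniform floor costs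
    [alpha * H] superfluous pulls in each of the [B / 2] even blocks.

    For (iii), arm 1 has mean 1 and rewards at most 1, hence pays 1 almost surely,
    and its index is never below 1. If arm 2 has [N] observations at an optional
    pull, its index is at least 1. On the event that all partial sums of arm 2 up
    to [T] stay below their mean plus [3 * sqrt (L * T)], this gives
    [Delta * N <= 3 * sqrt (L * T) + sqrt (2 * L * T)], and the last optional pull
    bounds the regret. Chernoff's bound and a union bound over [T] give the event
    probability at least [1 - eta]. Finally [T <= 2 * R], and [L] is at most a
    constant depending on [eta] times [log (2 * T)]. *)

Require Import Defs.
From HB Require Import structures.
From mathcomp Require Import all_boot all_order all_algebra.
From mathcomp Require Import all_classical all_reals all_analysis.
From mathcomp Require Import measurable_realfun.
From mathcomp Require Import zify ring lra.

Set Implicit Arguments.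
Unset Strict Implicit.
Unset Printing Implicit Defensive.

Import Order.TTheory GRing.Theory Num.Theory.
Import numFieldNormedType.Exports.

Local Open Scope classical_set_scope.
Local Open Scope ring_scope.

(** * Pull counts over intervals, blocks and arms *)

Lemma pulls_cat K (A : nat -> 'I_K) i r s t :
  (r <= s <= t)%N -> pulls A i r t = (pulls A i r s + pulls A i s t)%N.
Proof. by case/andP=> rs st; rewrite /pulls (big_cat_nat rs st). Qed.

Lemma pullsS K (A : nat -> 'I_K) i s t :
  (s <= t)%N -> pulls A i s t.+1 = (pulls A i s t + (A t == i))%N.
Proof. by move=> st; rewrite /pulls big_nat_recr. Qed.

Lemma pullsnn K (A : nat -> 'I_K) i s : pulls A i s s = 0%N.
Proof. by rewrite /pulls big_geq. Qed.

Lemma pulls_le K (A : nat -> 'I_K) i s t : (pulls A i s t <= t - s)%N.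
Proof.
rewrite /pulls -[leqRHS]muln1 -sum_nat_const_nat leq_sum // => u _.
by case: eqP.
Qed.

Lemma sum_pulls K (A : nat -> 'I_K) s t : (\sum_i pulls A i s t = t - s)%N.
Proof.
rewrite /pulls exchange_big /= -[RHS]muln1 -sum_nat_const_nat.
apply: eq_bigr => u _; rewrite (bigD1 (A u)) //= eqxx big1 // => i.
by rewrite eq_sym => /negbTE ->.
Qed.

Lemma pulls_blocks K (A : nat -> 'I_K) B H i :
  pulls A i 0 (B * H) = (\sum_(b < B) block_pulls H A b i)%N.
Proof.
elim: B => [|B IH]; first by rewrite big_ord0 pullsnn.
rewrite big_ord_recr /= -IH; apply: pulls_cat.
by rewrite leq0n leq_mul2r leqnSn orbT.
Qed.

Lemma pulls_arms (A : nat -> 'I_2) s t :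
  (pulls A arm1 s t + pulls A arm2 s t = t - s)%N.
Proof.
by rewrite -(sum_pulls A) big_ord_recl big_ord1; congr (_ + pulls _ _ _ _)%N.
Qed.

Lemma neq_arm1 (i : 'I_2) : (i != arm1) = (i == arm2).
Proof. by case: i => [[|[|]]]. Qed.

(** * Schedules with prescribed block counts *)

(** Realizes any prescribed counts [f b <= H] of arm 2 by pulling it first in each block. All
    witnesses for (i) and (ii) have this form. *)
Definition front_schedule (H : nat) (f : nat -> nat) (t : nat) : 'I_2 :=
  if (t %% H < f (t %/ H))%N then arm2 else arm1.

Lemma block_pulls_front H f b :
  (0 < H)%N -> (f b <= H)%N -> block_pulls H (front_schedule H f) b arm2 = f b.
Proof.
move=> H0 fH; rewrite /block_pulls /pulls.
rewrite -{1}[(b * H)%N]addn0 addnC big_addn mulSn addnK.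
rewrite (eq_big_nat _ _ (F2 := fun u => (u < f b)%N : nat)); last first.
  move=> u /andP[_ uH]; rewrite /front_schedule addnC divnMDl // divn_small //.
  by rewrite addn0 modnMDl modn_small //; case: ifP.
by rewrite -[RHS]muln1 -{2}[f b]subn0 -sum_nat_const_nat
  (big_cat_nat (n := f b)) //= [X in (_ + X)%N]big1_seq ?addn0;
  [apply: eq_big_nat => u /andP[_ ->]
  |move=> u /andP[_]; rewrite mem_index_iota => /andP[]; rewrite leqNgt => /negbTE ->].
Qed.

Lemma sum_alternate B n m : ~~ odd B ->
  (\sum_(b < B) (if odd_block b then n else m) = B./2 * (n + m))%N.
Proof.
move=> /even_halfK <-; rewrite doubleK; elim: (B./2) => [|k IH].
  by rewrite big_ord0.
rewrite doubleS !big_ord_recr /= IH /odd_block /= odd_double /=; lia.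
Qed.

(** * Moment bounds for independent bounded rewards *)

(** After multiplication by [1 - x], the left side is at most 1 because [1 - x <= expR (- x)], and
    the right side is [1 + x ^+ 2 * (1 - 2 * x)], at least 1 for [x <= 1/2]. *)
Lemma ger0_expR_le2 (R : realType) (x : R) :
  0 <= x <= 2^-1 -> expR x <= 1 + x + 2 * x ^+ 2.
Proof.
move=> /andP[x0 x12].
have h : (1 - x) * expR x <= 1.
  rewrite -ler_pdivlMr ?expR_gt0// -[leRHS]mul1r mul1r div1r -expRN.
  exact: expR_ge1Dx.
have : (1 - x) * expR x <= (1 - x) * (1 + x + 2 * x ^+ 2).
  apply: (le_trans h); nra.
by rewrite ler_pM2l//; lra.
Qed.

Section ProductOfSimpleFunctions.
Context (R : realType) (d : measure_display) (Omega : measurableType d).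
Context (P : probability Omega R) (I : choiceType) (X : I -> {RV P >-> R}).
Context (J : finType) (a : J -> R) (E : J -> set R).
Hypotheses (X_indep : mutually_independent X) (a_ge0 : forall j, 0 <= a j).
Hypothesis mE : forall j, measurable (E j).

Let phi (y : R) : R := \sum_j a j * \1_(E j) y.

Let phi_ge0 y : 0 <= phi y.
Proof. by apply: sumr_ge0 => j _; rewrite mulr_ge0. Qed.

Let measurable_phi (i : I) : measurable_fun setT (fun w => phi (X i w)).
Proof.
apply: (measurableT_comp (f := phi)) => //; apply: measurable_sum => j.
by apply: measurable_funM => //; exact: measurable_indic.
Qed.

Let measurable_cap (r : seq I) (F : I -> set R) :
  (forall i, i \in r -> measurable (F i)) ->
  measurable (\bigcap_(i in [set` r]) (X i @^-1` F i)).
Proof.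
move=> mF; apply: fin_bigcap_measurable; first exact: finite_seq.
move=> i /= ir; rewrite -[X in measurable X]setTI.
by apply: measurable_funPT => //; exact: mF.
Qed.

(* The indicator of a joint event of further indices makes the induction on [s]
   go through: expanding the first factor adds its index to that event. *)
Let integral_cap_prod (s r : seq I) (F : I -> set R) :
  uniq (s ++ r) -> (forall i, i \in r -> measurable (F i)) ->
  (\int[P]_w (\1_(\bigcap_(i in [set` r]) (X i @^-1` F i)) w *
             \prod_(i <- s) phi (X i w))%:E
   = (\prod_(i <- s) \sum_j (a j)%:E * P (X i @^-1` E j))
     * \prod_(i <- r) P (X i @^-1` F i))%E.
Proof.
elim: s r F => [|i s IH] r F /= => [ur|/andP[isr usr]] mF.
  under eq_integral do rewrite big_nil mulr1.
  rewrite big_nil mul1e integral_indic ?setIT; [|by []|exact: measurable_cap].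
  exact: X_indep.
have [nis nir] : i \notin s /\ i \notin r.
  by move: isr; rewrite mem_cat negb_or => /andP.
(* As [i] is not in [r], attaching [E j] to [i] leaves the events of [r] unchanged. *)
pose F' j k := if k == i then E j else F k.
have F'i j : F' j i = E j by rewrite /F' eqxx.
have F'r j k : k \in r -> F' j k = F k.
  by move=> kr; rewrite /F'; case: eqP => // ki; rewrite -ki kr in nir.
have capE j w : \1_(E j) (X i w) * \1_(\bigcap_(k in [set` r]) (X k @^-1` F k)) w
    = \1_(\bigcap_(k in [set` i :: r]) (X k @^-1` F' j k)) w :> R.
  rewrite !indicE -natrM mulnb; congr (_%:R); congr (nat_of_bool _).
  apply/idP/idP => [/andP[/set_mem Ej /set_mem Fr]|/set_mem Fr].
    apply/mem_set => k /=.
    rewrite inE => /orP[/eqP ->|kr]; first by rewrite F'i.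
    by rewrite F'r//; exact: Fr.
  apply/andP; split; apply/mem_set.
    by rewrite -(F'i j); apply: (Fr i) => /=; rewrite inE eqxx.
  by move=> k /= kr; rewrite -(F'r j)//; apply: Fr; rewrite /= inE kr orbT.
transitivity (\sum_j (a j)%:E * \int[P]_w
   (\1_(\bigcap_(k in [set` i :: r]) (X k @^-1` F' j k)) w *
             \prod_(i <- s) phi (X i w))%:E)%E.
  have mprod : measurable_fun setT (fun w => \prod_(i <- s) phi (X i w)).
    exact: measurable_prod.
  have mF' j k : k \in i :: r -> measurable (F' j k).
    rewrite inE => /orP[/eqP ->|kr]; first by rewrite F'i.
    by rewrite F'r//; exact: mF.
  have mint j : measurable_fun setT (fun w =>
     (\1_(\bigcap_(k in [set` i :: r]) (X k @^-1` F' j k)) w *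
             \prod_(i <- s) phi (X i w))%:E).
    apply/measurable_EFinP; apply: measurable_funM => //.
    by apply: measurable_indic; exact: (measurable_cap (mF' j)).
  have int0 j w : (0 <= (\1_(\bigcap_(k in [set` i :: r]) (X k @^-1` F' j k)) w *
             \prod_(i <- s) phi (X i w))%:E)%E.
    by rewrite lee_fin mulr_ge0// prodr_ge0.
  have pull_out j := ge0_integralZl_EFin P measurableT
    (fun w _ => int0 j w) (mint j) (a_ge0 j).
  rewrite -(eq_bigr _ (fun j _ => pull_out j)).
  rewrite -ge0_integral_sum//; last first.
  - by move=> j w _; rewrite mule_ge0// lee_fin.
  - by move=> j; exact: measurable_funeM.
  apply: eq_integral => w _; rewrite big_cons mulrCA mulr_suml.
  rewrite -sumEFin; apply: eq_bigr => j _.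
  by rewrite -capE -EFinM; congr (_%:E); rewrite !mulrA.
rewrite big_cons -muleA ge0_sume_distrl; last first.
  by move=> j _; rewrite mule_ge0// lee_fin.
apply: eq_bigr => j _; rewrite IH.
- rewrite big_cons F'i -!muleA; congr (_ * _)%E.
  rewrite muleCA; congr (_ * (_ * _))%E.
  by apply: eq_big_seq => k kr; rewrite F'r.
- by rewrite uniq_catC /= mem_cat negb_or nir nis uniq_catC.
- move=> k; rewrite inE => /orP[/eqP ->|kr]; first by rewrite F'i.
  by rewrite F'r//; exact: mF.
Qed.

Lemma integral_prod_simple (s : seq I) : uniq s ->
  (\int[P]_w (\prod_(i <- s) \sum_j a j * \1_(E j) (X i w))%:E
   = \prod_(i <- s) \sum_j (a j)%:E * P (X i @^-1` E j))%E.
Proof.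
move=> us; have := @integral_cap_prod s [::] (fun=> setT).
rewrite cats0 big_nil mule1 => <-//; apply: eq_integral => w _.
by rewrite set_nil bigcap_set0 indicT mul1r.
Qed.

End ProductOfSimpleFunctions.

(** The sum counts the integers of [[0, z]] below [k], hence equals the minimum of [k] and
    [floor z + 1]. *)
Lemma sum_nat_le_bounds (R : realType) (z : R) (k : nat) : 0 <= z ->
  Num.min z k%:R <= \sum_(j < k) (j%:R <= z)%R%:R <= z + 1.
Proof.
move=> z0; elim: k => [|k /andP[IHl IHu]].
  by rewrite big_ord0 ge_min lexx orbT; lra.
rewrite big_ord_recr /=; have [kz|zk] /= := leP k%:R z; last first.
  move: IHl; rewrite addr0 IHu andbT (min_l (ltW zk)) min_l//.
  by rewrite (le_trans (ltW zk))// ler_nat.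
have -> : \sum_(j < k) (j%:R <= z)%R%:R = k%:R :> R.
  rewrite -[X in X%:R]card_ord -sumr_const; apply: eq_bigr => j _.
  by rewrite (le_trans _ kz)// ler_nat ltnW.
by rewrite -[k.+1]addn1 natrD ge_min lexx orbT lerD2r kz.
Qed.

(* Independence is only about events, so the product rule is transferred from
   simple functions dominating the factors, with an error that vanishes. *)
Lemma integral_prod_affine (R : realType) (d : measure_display)
    (Omega : measurableType d) (P : probability Omega R) (I : choiceType)
    (X : I -> {RV P >-> R}) (mu c : R) (s : seq I) :
  mutually_independent X -> (forall i w, 0 <= X i w <= 1) ->
  (forall i, 'E_P[X i] = mu%:E)%E -> 0 <= c -> uniq s ->
  (\int[P]_w (\prod_(i <- s) (1 + c * X i w))%:E <= ((1 + c * mu) ^+ size s)%:E)%E.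
Proof.
move=> X_indep X01 EX c0 us.
have mX i : measurable_fun setT (fun w => (X i w)%:E) by exact/measurable_EFinP.
(* It is enough to allow an error [1 / k.+1] in [mu], which vanishes as [k] tends to infinity. *)
suff approx k : (\int[P]_w (\prod_(i <- s) (1 + c * X i w))%:E <=
    ((1 + c * (mu + k.+1%:R^-1)) ^+ size s)%:E)%E.
  have lim_bound : (fun k => (1 + c * (mu + k.+1%:R^-1)) ^+ size s) @ \oo -->
      (1 + c * mu) ^+ size s.
    apply: (@continuous_cvg _ R R \oo _ (fun k => 1 + c * (mu + k.+1%:R^-1))
      (fun y => y ^+ size s) (1 + c * mu)).
      exact: exprn_continuous.
    rewrite -[in X in _ --> X](addr0 mu).
    apply: cvgD; first exact: cvg_cst.
    apply: cvgM; first exact: cvg_cst.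
    apply: cvgD; first exact: cvg_cst.
    exact: cvg_harmonic.
  have {}lim_bound : (fun k => ((1 + c * (mu + k.+1%:R^-1)) ^+ size s)%:E) @ \oo -->
      ((1 + c * mu) ^+ size s)%:E by apply: cvg_EFin => //; exact: nearW.
  by apply: (cvge_to_ge lim_bound); exact: nearW.
(* [phi y] replaces [y] in [1 + c * y] by [1 / k.+1] times the number of grid
   points [j / k.+1 <= y], which overshoots [y] by at most [1 / k.+1]. *)
pose a (j : option 'I_k.+1) : R := if j is Some _ then c / k.+1%:R else 1.
pose E (j : option 'I_k.+1) : set R :=
  if j is Some j then `[j%:R / k.+1%:R, +oo[%classic else setT.
have a0 j : 0 <= a j by case: j => [j|] //=; rewrite divr_ge0.
have mE j : measurable (E j) by case: j => [j|] /=.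
have k0 : 0 < k.+1%:R :> R by [].
pose phi y := \sum_j a j * \1_(E j) y.
have phiE y : phi y = 1 + c / k.+1%:R * \sum_(j < k.+1) (j%:R <= k.+1%:R * y)%R%:R.
  (* The index [None] carries the constant term 1; the indices [Some j] count grid points. *)
  rewrite /phi (bigD1 None)//= indicT mul1r; congr (_ + _).
  rewrite (reindex_omap Some id) => [|[]//].
  rewrite mulr_sumr /=; apply: eq_big => [j|j _]; first by rewrite eqxx.
  by rewrite indicE mem_setE in_itv/= andbT ler_pdivrMr// [y * _]mulrC.
have phi_bounds y : 0 <= y <= 1 -> 1 + c * y <= phi y <= 1 + c / k.+1%:R + c * y.
  move=> /andP[y0 y1]; rewrite phiE.
  have := @sum_nat_le_bounds R (k.+1%:R * y) k.+1.
  rewrite mulr_ge0// min_l ?ler_piMr// => /(_ isT)/andP[hl hu].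
  have ck0 : 0 <= c / k.+1%:R by rewrite divr_ge0.
  have cE : c / k.+1%:R * (k.+1%:R * y) = c * y by rewrite mulrA divfK ?gt_eqF.
  apply/andP; split.
    by rewrite lerD2l -cE ler_wpM2l.
  have := ler_wpM2l ck0 hu.
  by rewrite mulrDr cE mulr1 -addrA lerD2l [X in _ -> _ <= X]addrC.
have phi_meas i : measurable_fun setT (fun w => phi (X i w)).
  apply: (measurableT_comp (f := phi)) => //; apply: measurable_sum => j.
  by apply: measurable_funM => //; exact: measurable_indic.
apply: (@le_trans _ _ (\int[P]_w (\prod_(i <- s) phi (X i w))%:E)%E).
  apply: ge0_le_integral => //.
  - move=> w _; rewrite lee_fin prodr_ge0// => i _.
    by have /andP[X0 _] := X01 i w; rewrite addr_ge0// mulr_ge0.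
  - apply/measurable_EFinP; apply: measurable_prod => i _.
    by apply: measurable_funD => //; apply: measurable_funM.
  - by apply/measurable_EFinP; apply: measurable_prod.
  - move=> w _; rewrite lee_fin ler_prod// => i _.
    have /andP[X0 _] := X01 i w; rewrite addr_ge0 ?mulr_ge0//=.
    by have /andP[] := phi_bounds _ (X01 i w).
rewrite (integral_prod_simple X_indep a0 mE us).
(* For a single index the product formula, read backwards, gives the integral of [phi (X i)], and
   [phi y <= 1 + c / k.+1 + c * y] on [[0, 1]]. *)
have factor i : (\sum_j (a j)%:E * P (X i @^-1` E j) <= (1 + c * (mu + k.+1%:R^-1))%:E)%E.
  have -> : (\sum_j (a j)%:E * P (X i @^-1` E j) = \int[P]_w (phi (X i w))%:E)%E.
    have := @integral_prod_simple _ _ _ _ _ _ _ _ _ X_indep a0 mE [:: i] isT.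
    by rewrite big_seq1 => <-; apply: eq_integral => w _; rewrite big_seq1.
  apply: (@le_trans _ _ (\int[P]_w ((1 + c / k.+1%:R)%:E + c%:E * (X i w)%:E))%E).
    apply: ge0_le_integral => //.
    - move=> w _; rewrite lee_fin.
      have /andP[X0 _] := X01 i w.
      have /andP[lb _] := phi_bounds _ (X01 i w).
      by apply: le_trans lb; rewrite addr_ge0 ?mulr_ge0.
    - exact/measurable_EFinP.
    - by apply: emeasurable_funD => //; exact: measurable_funeM.
    - move=> w _; rewrite -EFinM -EFinD lee_fin.
      by have /andP[] := phi_bounds _ (X01 i w).
  rewrite ge0_integralD//=.
  - rewrite integral_cst//= probability_setT mule1 ge0_integralZl//=.
    + have := EX i; rewrite unlock => ->.
      by rewrite -EFinM -EFinD lee_fin mulrDr -addrA lerD2l addrC.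
    + by move=> w _; rewrite lee_fin; have /andP[] := X01 i w.
  - by move=> w _; rewrite lee_fin addr_ge0// divr_ge0.
  - by move=> w _; rewrite mule_ge0// lee_fin; have /andP[] := X01 i w.
  - exact: measurable_funeM.
elim: s {us} => [|i s IH]; first by rewrite !big_nil.
rewrite big_cons exprS EFinM lee_pmul//; last first.
  by apply: prode_ge0 => i' _; apply: sume_ge0 => j _; rewrite mule_ge0 // lee_fin.
by apply: sume_ge0 => j _; rewrite mule_ge0 // lee_fin.
Qed.

(** * Measurability, expectations and Chernoff's bound *)

Lemma measurable_ge (R : realType) (d : measure_display) (T : measurableType d)
    (f : T -> R) (y : R) :
  measurable_fun setT f -> measurable [set w | y <= f w].
Proof.
move=> mf; rewrite (_ : mkset _ = setT `&` f @^-1` `[y, +oo[%classic).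
  exact: mf.
by apply/seteqP; split => w /=; rewrite in_itv/= andbT => // -[].
Qed.

Lemma expectation_01 (R : realType) (d : measure_display)
    (Omega : measurableType d) (P : probability Omega R) (X : {RV P >-> R}) (mu : R) :
  (forall w, 0 <= X w <= 1) -> ('E_P[X] = mu%:E)%E -> 0 <= mu <= 1.
Proof.
move=> X01 EX; rewrite -!lee_fin -EX; apply/andP; split.
  by apply: expectation_ge0 => w; have /andP[] := X01 w.
rewrite -(expectation_cst P 1); apply: expectation_le => //.
- by move=> w; have /andP[] := X01 w.
- by apply/aeW => w; have /andP[] := X01 w.
Qed.

(** The function [1 - X] is nonnegative with integral 0, so it vanishes almost everywhere. *)
Lemma expectation_eq1 (R : realType) (d : measure_display)
    (Omega : measurableType d) (P : probability Omega R) (X : {RV P >-> R}) :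
  (forall w, 0 <= X w <= 1) -> ('E_P[X] = 1)%E -> P [set w | X w != 1] = 0%E.
Proof.
move=> X01 EX.
have mY : measurable_fun setT (fun w => (1 - X w)%:E).
  by apply/measurable_EFinP; apply: measurable_funB.
have Y0 : (\int[P]_w (1 - X w)%:E = 0)%E.
  have : ('E_P[X] + \int[P]_w (1 - X w)%:E = 1)%E.
    rewrite unlock -ge0_integralD//.
    - under eq_integral do rewrite -EFinD addrC subrK.
      by rewrite integral_cst//= probability_setT mule1.
    - by move=> w _; rewrite lee_fin; have /andP[] := X01 w.
    - exact/measurable_EFinP.
    - by move=> w _; rewrite lee_fin subr_ge0; have /andP[] := X01 w.
  rewrite EX; case: (\int[P]_w _)%E => [r| |]//.
  by move=> /eqP; rewrite -EFinD eqe => /eqP h; congr (_%:E); lra.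
have [N [mN PN XN]] : ae_eq P setT (fun w => (1 - X w)%:E) (cst 0%E).
  apply/ae_eq_integral_abs => //.
  rewrite -[RHS]Y0; apply: eq_integral => w _.
  by rewrite gee0_abs// lee_fin subr_ge0; have /andP[] := X01 w.
apply/eqP; rewrite eq_le measure_ge0 andbT -PN; apply: le_measure.
- rewrite inE (_ : mkset _ = setT `&` X @^-1` (~` [set 1])).
    by apply: measurable_funPT => //; exact: measurableC.
  by rewrite setTI; apply/seteqP; split => w /= /eqP.
- by rewrite inE.
- move=> w /= Xw; apply: XN => /= /(_ I)[] /eqP.
  by rewrite subr_eq0 eq_sym (negbTE Xw).
Qed.

(** Exponential Markov inequality. On [[0, 1]] one has [expR (l * X) <= 1 + (l + 2 * l ^+ 2) * X],
    an affine factor to which [integral_prod_affine] applies. The parameter [l] is left open for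
    later tuning. *)
Lemma chernoff_sum (R : realType) (d : measure_display)
    (Omega : measurableType d) (P : probability Omega R) (I : choiceType)
    (X : I -> {RV P >-> R}) (mu l t : R) (s : seq I) :
  mutually_independent X -> (forall i w, 0 <= X i w <= 1) ->
  (forall i, 'E_P[X i] = mu%:E)%E -> 0 <= mu <= 1 -> 0 <= l <= 2^-1 -> uniq s ->
  (P [set w | ((size s)%:R * mu + t <= \sum_(i <- s) X i w)%R]
   <= (expR (2 * (size s)%:R * l ^+ 2 - l * t))%:E)%E.
Proof.
move=> X_indep X01 EX /andP[mu0 mu1] l012 us.
have /andP[l0 l12] := l012.
pose c := l + 2 * l ^+ 2.
have c0 : 0 <= c by rewrite /c addr_ge0// mulr_ge0// sqr_ge0.
set V := [set w | _]; set n : R := (size s)%:R.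
have n0 : 0 <= n by rewrite ler0n.
have mS : measurable_fun setT (fun w => \sum_(i <- s) X i w).
  exact: measurable_sum.
have mV : measurable V by exact: measurable_ge.
have markov : ((expR (l * (n * mu + t)))%:E * P V <= (expR (n * (c * mu)))%:E)%E.
  apply: (@le_trans _ _ (\int[P]_w (\prod_(i <- s) (1 + c * X i w))%:E)%E); last first.
    apply: (le_trans (integral_prod_affine X_indep X01 EX c0 us)).
    rewrite lee_fin /n expRM_natl lerXn2r// ?nnegrE ?expR_ge0//.
      by rewrite addr_ge0// mulr_ge0.
    exact: expR_ge1Dx.
  have -> : P V = (\int[P]_w (\1_V w)%:E)%E by rewrite integral_indic// setIT.
  rewrite -ge0_integralZl_EFin ?expR_ge0//; last first.
    by apply/measurable_EFinP; exact: measurable_indic.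
  apply: ge0_le_integral => //.
  - by apply: measurable_funeM; apply/measurable_EFinP; exact: measurable_indic.
  - apply/measurable_EFinP; apply: measurable_prod => i _.
    by apply: measurable_funD => //; apply: measurable_funM.
  - move=> w _; rewrite -EFinM lee_fin indicE.
    have prod0 : 0 <= \prod_(i <- s) (1 + c * X i w).
      apply: prodr_ge0 => i _.
      by have /andP[X0 _] := X01 i w; rewrite addr_ge0// mulr_ge0.
    case: (boolP (w \in V)) => [/set_mem Vw|_]; rewrite ?mulr0// mulr1.
    apply: (@le_trans _ _ (expR (l * \sum_(i <- s) X i w))).
      by rewrite ler_expR ler_wpM2l.
    rewrite mulr_sumr expR_sum ler_prod// => i _; rewrite expR_ge0/=.
    have /andP[X0 X1] := X01 i w.
    apply: (le_trans (ger0_expR_le2 _)); first by rewrite mulr_ge0//=; nra.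
    have : l ^+ 2 * X i w ^+ 2 <= l ^+ 2 * X i w.
      by rewrite ler_wpM2l ?sqr_ge0// expr2 ler_piMr.
    rewrite /c exprMn; lra.
have -> : P V = ((expR (- (l * (n * mu + t))))%:E *
    ((expR (l * (n * mu + t)))%:E * P V))%E.
  by rewrite muleA -EFinM -expRD addNr expR0 mul1e.
apply: (le_trans (lee_wpmul2l _ markov)); first by rewrite lee_fin expR_ge0.
rewrite -EFinM -expRD lee_fin ler_expR /c.
(* The terms [l * n * mu] cancel, and [mu <= 1] bounds what remains of the quadratic term. *)
have : n * l ^+ 2 * mu <= n * l ^+ 2 by rewrite ler_piMr// mulr_ge0// sqr_ge0.
lra.
Qed.

(** * Deterministic analysis of BDQ-UCB *)

Lemma bdq_ucb_meets (R : realType) K B H (m : nat -> 'I_K -> nat) (eta : R) x A :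
  (forall b, (b < B)%N -> (\sum_j m b j <= H)%N) ->
  bdq_ucb B H m eta x A -> meets_blockwise B H m A.
Proof.
move=> mH bdq b i bB; have [<- _] := bdq b bB.
rewrite /block_pulls (@pulls_cat _ A i _ (b * H + \sum_j m b j) (b.+1 * H)).
  by rewrite leq_addr.
by rewrite leq_addr mulSn addnC leq_add2r mH.
Qed.

(** The pull of [i] preceded by [n] pulls of [i] reads entry [n] of its row, so the observations of
    [i] form an initial segment of that row. Deviation bounds valid at every fixed count thus apply
    at adaptively chosen counts. *)
Lemma sum_reward (R : realType) K (x : 'I_K -> nat -> R) (A : nat -> 'I_K) t i :
  \sum_(s < t | A s == i) reward x A s = \sum_(0 <= n < pulls A i 0 t) x i n.
Proof.
elim: t => [|t IH]; first by rewrite big_ord0 pullsnn big_geq.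
rewrite big_mkcond big_ord_recr /= -big_mkcond /= IH pullsS//.
case: eqP => [Ati|_]; last by rewrite addr0 addn0.
by rewrite addn1 big_nat_recr//= /reward Ati.
Qed.

(* [Q] bounds the number of earlier pulls of [i] at every optional pull of [i],
   so the last optional pull brings the count to at most [Q + 1] plus floors. *)
Lemma pulls_le_of_optional (R : realType) K B H (m : nat -> 'I_K -> nat)
    (A : nat -> 'I_K) (i : 'I_K) (Q : R) :
  (forall b, (b < B)%N -> (\sum_j m b j <= H)%N) -> 0 <= Q ->
  (forall b, (b < B)%N -> pulls A i (b * H) (b * H + \sum_j m b j) = m b i) ->
  (forall b t, (b < B)%N -> (b * H + \sum_j m b j <= t < b.+1 * H)%N ->
     A t = i -> (pulls A i 0 t)%:R <= Q) ->
  (pulls A i 0 (B * H))%:R <= Q + 1 + (\sum_(b < B) m b i)%:R.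
Proof.
move=> mH Q0 mand opt_le.
suff block b : (b <= B)%N ->
    (pulls A i 0 (b * H))%:R <= Q + 1 + (\sum_(b' < b) m b' i)%:R by exact: block.
elim: b => [_|b IH bB].
  by rewrite mul0n pullsnn big_ord0 addr0 addr_ge0.
set M := (b * H + \sum_j m b j)%N.
have MH : (M <= b.+1 * H)%N by rewrite /M mulSn addnC leq_add2r mH.
suff upto k : (M + k <= b.+1 * H)%N ->
    (pulls A i 0 (M + k))%:R <= Q + 1 + (\sum_(b' < b.+1) m b' i)%:R.
  by have := upto (b.+1 * H - M)%N; rewrite subnKC// => /(_ (leqnn _)).
elim: k => [_|k IHk kH].
  rewrite addn0 (@pulls_cat _ _ _ _ (b * H)) ?leq0n ?leq_addr// mand// big_ord_recr /=.
  by rewrite !natrD addrA lerD2r IH// ltnW.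
rewrite addnS in kH *; rewrite pullsS// natrD.
case: eqP => [Ai|_]; last by rewrite addr0 IHk// ltnW.
have := opt_le b (M + k)%N bB; rewrite leq_addr kH => /(_ isT Ai) hQ.
by rewrite -[leLHS]addr0 lerD// lerD2r.
Qed.

Lemma regret_arm1 (R : realType) B H (m : nat -> 'I_2 -> nat) (mu : 'I_2 -> R) A :
  regret B H m mu arm1 A =
    (mu arm1 - mu arm2) *
    ((pulls A arm2 0 (B * H))%:R - (\sum_(b < B) m b arm2)%:R).
Proof.
rewrite /regret /opt.
have -> : \sum_(b < B) \sum_(i < 2 | i != arm1) (m b i)%:R * (mu arm1 - mu i) =
    (\sum_(b < B) m b arm2)%:R * (mu arm1 - mu arm2).
  rewrite natr_sum mulr_suml; apply: eq_bigr => b _.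
  by rewrite (eq_bigl _ _ neq_arm1) big_pred1_eq.
have -> : \sum_(t < B * H) mu (A t) = (B * H)%:R * mu arm1 -
    (pulls A arm2 0 (B * H))%:R * (mu arm1 - mu arm2).
  elim: (B * H)%N => [|T IH]; first by rewrite big_ord0 pullsnn; lra.
  rewrite big_ord_recr /= IH pullsS// natrD -natr1.
  by case: (eqVneq (A T) arm2) => [->|]; [|rewrite -neq_arm1 negbK => /eqP ->] => /=; lra.
lra.
Qed.

(** The index of arm 2 must reach that of arm 1, which is at least 1. Multiplying by the count [n]
    of arm 2 turns the bonus into [sqrt (2 * L * n)], and [n <= T]. *)
Lemma ucb_optional_pull (R : realType) (T : nat) (eta s : R)
    (x : 'I_2 -> nat -> R) (A : nat -> 'I_2) (t : nat) (mu2 : R) :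
  (t < T)%N -> 0 <= s -> 0 <= log_term 2 T eta ->
  (forall n, (n < T)%N -> x arm1 n = 1) ->
  (forall n, (0 < n <= T)%N -> \sum_(0 <= k < n) x arm2 k < n%:R * mu2 + s) ->
  A t = arm2 ->
  (ucb_index T eta x A t arm1 <= ucb_index T eta x A t arm2)%E ->
  (1 - mu2) * (pulls A arm2 0 t)%:R <= s + Num.sqrt (2 * log_term 2 T eta * T%:R).
Proof.
move=> tT s0 L0 x1 x2 At; rewrite /ucb_index; set L := log_term 2 T eta in L0 *.
have pT i : (pulls A i 0 t <= T)%N.
  by rewrite (leq_trans (pulls_le _ _ _ _))// subn0 ltnW.
case: (posnP (pulls A arm2 0 t)) => [->|n0].
  by rewrite mulr0 addr_ge0 ?sqrtr_ge0.
(* An unobserved arm 1 has index [+oo], which the finite index of an observed arm 2 cannot match. *)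
case: (posnP (pulls A arm1 0 t)) => [_|n10]; first by rewrite leNgt ltry.
rewrite lee_fin /emp_mean !sum_reward.
set n := pulls A arm2 0 t in n0 *; set n1 := pulls A arm1 0 t in n10 *.
have -> : \sum_(0 <= k < n1) x arm1 k = n1%:R.
  rewrite -[X in X%:R]subn0 -sumr_const_nat; apply: eq_big_nat => k /andP[_ kn].
  by rewrite x1// (leq_trans kn (pT _))//.
rewrite divff ?pnatr_eq0 -?lt0n// => idx.
have nT : (0 < n <= T)%N by rewrite n0 pT.
have nR : 0 < n%:R :> R by rewrite ltr0n.
have {idx} : 1 <= (\sum_(0 <= k < n) x arm2 k) / n%:R + Num.sqrt (2 * L / n%:R).
  by apply: le_trans idx; rewrite lerDl sqrtr_ge0.
rewrite -(ler_pM2r nR) mul1r mulrDl divfK ?gt_eqF// => h.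
have : Num.sqrt (2 * L / n%:R) * n%:R <= Num.sqrt (2 * L * T%:R).
  rewrite -{2}(sqr_sqrtr (ltW nR)) expr2 mulrA -sqrtrM; last first.
    by rewrite mulr_ge0// ?invr_ge0 ?ler0n// mulr_ge0.
  rewrite divfK ?gt_eqF// -sqrtrM ?mulr_ge0// ler_wsqrtr//.
  by rewrite ler_wpM2l ?mulr_ge0// ler_nat; case/andP: nT.
have := x2 n nT; lra.
Qed.

(** * Counting for global and uniform floors *)

Lemma sum_alternating_floor (B aH : nat) : ~~ odd B ->
  (\sum_(b < B) alternating_floor aH b arm2 = B./2 * aH)%N.
Proof.
move=> Beven; rewrite -[aH in RHS]addn0 -sum_alternate//.
by apply: eq_bigr => b _; rewrite /alternating_floor eqxx andbT.
Qed.

Lemma alternating_floor_le (H aH b : nat) : (aH.*2 <= H)%N ->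
  ((\sum_j alternating_floor aH b j).*2 <= H)%N.
Proof.
rewrite big_ord_recl big_ord1 /alternating_floor /= andbF add0n.
by case: ifP.
Qed.

Lemma pulls_front B H f : (0 < H)%N -> (forall b, (f b <= H)%N) ->
  pulls (front_schedule H f) arm2 0 (B * H) = (\sum_(b < B) f b)%N.
Proof.
by move=> H0 fH; rewrite pulls_blocks; apply: eq_bigr => b _; rewrite block_pulls_front.
Qed.

(** A condition on totals cannot separate two schedules with equal totals, of which only one meets
    the odd-block floors. *)
Lemma global_floor_insufficient (R : realType) (B H aH : nat) (G : 'I_2 -> R) :
  (0 < B)%N -> ~~ odd B -> (0 < H)%N -> (0 < aH <= H)%N ->
  ~ (forall A : nat -> 'I_2, meets_global B H G A <->
       meets_blockwise B H (alternating_floor aH) A).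
Proof.
move=> B0 Beven H0 /andP[aH0 aHH] equiv.
(* [f] serves the quota in the odd blocks and [g] in the even ones; the totals agree because [B] is
   even. *)
pose f b := if odd_block b then aH else 0%N.
pose g b := if odd_block b then 0%N else aH.
have fH b : (f b <= H)%N by rewrite /f; case: ifP.
have gH b : (g b <= H)%N by rewrite /g; case: ifP.
have fgE i : pulls (front_schedule H f) i 0 (B * H) =
             pulls (front_schedule H g) i 0 (B * H).
  have E2 : pulls (front_schedule H f) arm2 0 (B * H) =
            pulls (front_schedule H g) arm2 0 (B * H).
    by rewrite !pulls_front// !sum_alternate// addn0.
  case: (eqVneq i arm2) => [->//|]; rewrite -neq_arm1 negbK => /eqP ->.
  (* The counts of both arms add up to the horizon, so equality for arm 2 gives equality for arm
     1. *)
  by apply/eqP; rewrite -(eqn_add2r (pulls (front_schedule H f) arm2 0 (B * H)))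
    {2}E2 !pulls_arms.
have /equiv good : meets_blockwise B H (alternating_floor aH) (front_schedule H f).
  move=> b i bB; rewrite /alternating_floor.
  by case: (eqVneq i arm2) => [->|]; rewrite ?andbF// andbT block_pulls_front.
(* Index 0 is an odd block, in which [g] never pulls arm 2. *)
have /equiv/(_ 0%N arm2 B0) : meets_global B H G (front_schedule H g).
  by move=> i; rewrite -fgE; exact: good.
by rewrite block_pulls_front// /alternating_floor /= leqNgt aH0.
Qed.

Lemma aggregate_without_blockwise (B H aH : nat) :
  ~~ odd B -> (0 < H)%N -> (0 < aH <= H)%N ->
  exists A : nat -> 'I_2,
    pulls A arm2 0 (B * H) = (\sum_(b < B) alternating_floor aH b arm2)%N /\
    forall b, (b < B)%N -> odd_block b ->
      (block_pulls H A b arm2 < alternating_floor aH b arm2)%N.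
Proof.
move=> Beven H0 /andP[aH0 aHH].
pose g b := if odd_block b then 0%N else aH.
have gH b : (g b <= H)%N by rewrite /g; case: ifP.
exists (front_schedule H g); split.
  by rewrite pulls_front// sum_alternating_floor// sum_alternate.
by move=> b bB bodd; rewrite block_pulls_front// /g /alternating_floor bodd eqxx.
Qed.

(** Integrality of [g * H] provides a whole number of pulls that meets the uniform bound and stays
    below [aH]; rounding up a fractional bound could reach [aH]. *)
Lemma uniform_below_floor (R : realType) (B H aH : nat) (g : R) :
  (0 < H)%N -> (aH <= H)%N -> (0 < aH)%N -> g * H%:R < aH%:R ->
  g * H%:R \is a Num.int ->
  exists A : nat -> 'I_2, meets_uniform B H arm2 g A /\
    forall b, (b < B)%N -> odd_block b ->
      (block_pulls H A b arm2 < alternating_floor aH b arm2)%N.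
Proof.
move=> H0 aHH aH0 gaH /intrP[z gz].
have [n [ngH gHn]] : exists n : nat, (n < aH)%N /\ g * H%:R <= n%:R.
  (* For negative [z], zero pulls suffice. *)
  case: z gz => [n|n] gz; last by exists 0%N; split => //; rewrite gz mulr0n lerz0.
  by exists n; rewrite -(ltr_nat R) gz; move: gaH; rewrite gz.
have nH : (n <= H)%N by rewrite ltnW// (leq_trans ngH).
exists (front_schedule H (fun=> n)); split => [b _|b _ bodd].
  by rewrite block_pulls_front.
by rewrite block_pulls_front// /alternating_floor bodd eqxx.
Qed.

Lemma regret_uniform (R : realType) (B H aH : nat) (mu : 'I_2 -> R) (g : R) A :
  ~~ odd B -> mu arm2 <= mu arm1 -> aH%:R <= g * H%:R ->
  meets_uniform B H arm2 g A ->
  (mu arm1 - mu arm2) * (B%:R / 2 * aH%:R) <=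
    regret B H (alternating_floor aH) mu arm1 A.
Proof.
move=> Beven mu21 aHg unif; rewrite regret_arm1 ler_wpM2l ?subr_ge0//.
have : (B * aH)%:R <= (pulls A arm2 0 (B * H))%:R :> R.
  rewrite ler_nat pulls_blocks -{1}(card_ord B) -sum_nat_const.
  apply: leq_sum => b _; rewrite -(ler_nat R); apply: (le_trans aHg).
  by apply: unif.
have BE : B%:R = 2 * (B./2)%:R :> R.
  by rewrite -natrM mul2n even_halfK.
rewrite sum_alternating_floor// !natrM BE; lra.
Qed.

(** * High-probability regret of BDQ-UCB *)

(** At an optional pull of arm 2 its earlier count is at most [(s + V) / (1 - mu arm2)]. The gap
    cancels against the loss per pull, so the bound is free of it. The term 1 pays for the last
    optional pull, which costs [1 - mu arm2 <= 1]. *)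
Lemma bdq_ucb_regret (R : realType) (B H aH : nat) (eta s : R) (mu : 'I_2 -> R)
    (x : 'I_2 -> nat -> R) (A : nat -> 'I_2) :
  (aH.*2 <= H)%N -> mu arm1 = 1 -> 0 <= mu arm2 < 1 -> 0 <= s ->
  0 <= log_term 2 (B * H) eta ->
  (forall n, (n < B * H)%N -> x arm1 n = 1) ->
  (forall n, (0 < n <= B * H)%N ->
     \sum_(0 <= k < n) x arm2 k < n%:R * mu arm2 + s) ->
  bdq_ucb B H (alternating_floor aH) eta x A ->
  regret B H (alternating_floor aH) mu arm1 A <=
    1 + s + Num.sqrt (2 * log_term 2 (B * H) eta * (B * H)%:R).
Proof.
move=> aHH mu1 /andP[mu20 mu21] s0 L0 x1 x2 bdq.
set V := Num.sqrt _; have V0 : 0 <= V by exact: sqrtr_ge0.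
have mH b : (b < B)%N -> (\sum_j alternating_floor aH b j <= H)%N.
  by move=> _; have := @alternating_floor_le H aH b aHH; lia.
have D0 : 0 < 1 - mu arm2 by lra.
have := @pulls_le_of_optional R 2 B H _ A arm2 ((s + V) / (1 - mu arm2)) mH.
have Q0 : 0 <= (s + V) / (1 - mu arm2) by rewrite divr_ge0 ?(ltW D0)// addr_ge0.
move=> /(_ Q0) bound.
have {bound} : (pulls A arm2 0 (B * H))%:R <= (s + V) / (1 - mu arm2) + 1 +
    (\sum_(b < B) alternating_floor aH b arm2)%:R.
  apply: bound => [b bB|b t bB tM At].
    by have [] := bdq b bB.
  rewrite ler_pdivlMr// mulrC.
  have tBH : (t < B * H)%N.
    by case/andP: tM => _ /leq_trans; apply; rewrite leq_mul2r bB orbT.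
  apply: (@ucb_optional_pull R (B * H) eta s x A t (mu arm2)) => //.
  by have [_ /(_ t tM arm1)] := bdq b bB; rewrite At.
rewrite regret_arm1 mu1 => bound.
have : (1 - mu arm2) * ((pulls A arm2 0 (B * H))%:R -
    (\sum_(b < B) alternating_floor aH b arm2)%:R) <=
    (1 - mu arm2) * ((s + V) / (1 - mu arm2) + 1).
  by apply: ler_wpM2l; [exact: ltW|rewrite lerBlDr].
have -> : (1 - mu arm2) * ((s + V) / (1 - mu arm2) + 1) = s + V + (1 - mu arm2).
  by rewrite mulrDr mulr1 mulrCA mulfV ?mulr1// gt_eqF.
lra.
Qed.

(** The deviation is measured on the scale of [T] instead of [n], so that one radius serves every
    count in the union bound. *)
Lemma deviation_bound (R : realType) (d : measure_display)
    (Omega : measurableType d) (P : probability Omega R)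
    (X : nat -> {RV P >-> R}) (mu L : R) (n T : nat) :
  mutually_independent X -> (forall i w, 0 <= X i w <= 1) ->
  (forall i, 'E_P[X i] = mu%:E)%E -> 0 <= L -> (n <= T)%N -> (0 < T)%N ->
  (P [set w | (n%:R * mu + 3 * Num.sqrt (L * T%:R) <= \sum_(0 <= i < n) X i w)%R]
   <= (expR (- L))%:E)%E.
Proof.
move=> X_indep X01 EX L0 nT T0.
have mu01 := expectation_01 (X01 0%N) (EX 0%N).
have TR : 0 < T%:R :> R by rewrite ltr0n.
have nTR : n%:R <= T%:R :> R by rewrite ler_nat.
(* If [4 * L > T] the deviation exceeds [n]; otherwise the exponent
   [sqrt (L / T)] is admissible in [chernoff_sum]. *)
have [LT|LT] := leP (4 * L) T%:R; last first.
  rewrite (_ : mkset _ = set0) ?measure0 ?lee_fin ?expR_ge0//.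
  rewrite -subset0 => w /=; apply/negP; rewrite -ltNge.
  have : \sum_(0 <= i < n) X i w <= n%:R.
    rewrite -[n in n%:R]subn0 -sumr_const_nat ler_sum// => i _.
    by have /andP[] := X01 i w.
  have : T%:R / 2 < Num.sqrt (L * T%:R).
    rewrite -(@ltr_pXn2r _ 2) ?nnegrE ?sqrtr_ge0 ?divr_ge0 ?ltW//.
    by rewrite sqr_sqrtr ?mulr_ge0 ?ltW//; nra.
  have : 0 <= n%:R * mu by rewrite mulr_ge0//; case/andP: mu01.
  lra.
pose l := Num.sqrt (L / T%:R).
have l2 : l ^+ 2 = L / T%:R by rewrite sqr_sqrtr// divr_ge0// ltW.
have l012 : 0 <= l <= 2^-1.
  rewrite sqrtr_ge0/= -(@ler_pXn2r _ 2) ?nnegrE ?sqrtr_ge0 ?invr_ge0//.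
  rewrite l2 ler_pdivrMr// expr2; lra.
have := @chernoff_sum _ _ _ P _ X mu l (3 * Num.sqrt (L * T%:R)) (index_iota 0 n)
  X_indep X01 EX mu01 l012 (iota_uniq _ _).
rewrite size_iota subn0 => /le_trans; apply.
(* The exponent is [2 * n * L / T - 3 * L], at most [- L] since [n <= T]. *)
rewrite lee_fin ler_expR l2.
have -> : l * (3 * Num.sqrt (L * T%:R)) = 3 * L.
  rewrite mulrCA /l -sqrtrM ?divr_ge0 ?(ltW TR)//.
  by rewrite mulrA mulrAC divfK ?gt_eqF// -expr2 sqrtr_sqr ger0_norm.
have : n%:R * (L / T%:R) <= L.
  by rewrite mulrCA ler_piMr // ler_pdivrMr ?mul1r.
lra.
Qed.

(** The event concerns the reward table alone, whatever arms the policy picks. Arm 1 contributes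
    only null sets to its complement. *)
Lemma bdq_ucb_good_event (R : realType) (T : nat) (eta : R) (mu : 'I_2 -> R)
    (d : measure_display) (Omega : measurableType d) (P : probability Omega R)
    (X : 'I_2 -> nat -> {RV P >-> R}) :
  0 < eta < 1 -> (0 < T)%N -> bandit_rewards mu X -> mu arm1 = 1 ->
  let s := 3 * Num.sqrt (log_term 2 T eta * T%:R) in
  exists E : set Omega, [/\ measurable E, ((1 - eta)%:E <= P E)%E &
    forall w, E w ->
      (forall n, (n < T)%N -> X arm1 n w = 1) /\
      (forall n, (0 < n <= T)%N ->
         \sum_(0 <= k < n) X arm2 k w < n%:R * mu arm2 + s)].
Proof.
move=> /andP[eta0 eta1] T0 rew mu1 s.
set L := log_term 2 T eta in s *.
have TR : 0 < T%:R :> R by rewrite ltr0n.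
have T1 : 1 <= T%:R :> R by rewrite ler1n.
have ratio1 : 1 <= 2 * 2%:R * T%:R / eta.
  by rewrite ler_pdivlMr// mul1r; lra.
have L0 : 0 <= L by exact: ln_ge0.
have [_ X01_1 EX_1] := rew arm1; have [indep2 X01_2 EX_2] := rew arm2.
pose Z n := [set w | X arm1 n w != 1].
(* The shift lets [n < T] index both the entries 0 to [T - 1] of arm 1 and the counts 1 to [T] of
   arm 2. *)
pose D n := [set w | n.+1%:R * mu arm2 + s <= \sum_(0 <= k < n.+1) X arm2 k w].
have mZ n : measurable (Z n).
  rewrite (_ : Z n = setT `&` X arm1 n @^-1` (~` [set 1])).
    by apply: measurable_funPT => //; exact: measurableC.
  by rewrite setTI; apply/seteqP; split => w /= /eqP.
have mD n : measurable (D n).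
  by apply: measurable_ge; exact: measurable_sum.
pose bad := \big[setU/set0]_(n < T) (Z n `|` D n).
have mbad : measurable bad.
  by apply: bigsetU_measurable => n _; exact: measurableU.
exists (~` bad); split; first exact: measurableC.
  rewrite probability_setC// EFinB leeB//.
  have badT : bad `<=` \big[setU/set0]_(n < T) (Z n `|` D n) by [].
  have mZD n : (n < T)%N -> measurable (Z n `|` D n) by move=> _; exact: measurableU.
  apply: (le_trans (@content_subadditive _ _ _ P bad _ T mZD mbad badT)).
  apply: (@le_trans _ _ (\sum_(n < T) (eta / T%:R)%:E)%E); last first.
    by rewrite sumEFin lee_fin sumr_const card_ord -[leLHS]mulr_natr divfK ?gt_eqF.
  apply: lee_sum => n _.
  apply: (@le_trans _ _ (P (Z n) + P (D n))%E); first exact: measureU2.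
  have -> : P (Z n) = 0%E by apply: expectation_eq1; rewrite // EX_1 mu1.
  rewrite add0e.
  apply: (le_trans (deviation_bound indep2 X01_2 EX_2 L0 (ltn_ord n) T0)).
  (* With two arms, [expR (- L) = eta / (4 * T)], which is below the share [eta / T] of each [n]. *)
  rewrite lee_fin expRN lnK ?posrE ?(lt_le_trans ltr01)// invf_div.
  by rewrite ler_pM2l// lef_pV2 ?posrE ?mulr_gt0//; lra.
move=> w nbad; split => [n nT|[//|n] /= nT].
  apply/eqP/negPn/negP => Zn; apply: nbad.
  by rewrite /bad -(bigcup_mkord T (fun n => Z n `|` D n)); exists n => //; left.
rewrite ltNge; apply/negP => Dn; apply: nbad.
by rewrite /bad -(bigcup_mkord T (fun n => Z n `|` D n)); exists n => //; right.
Qed.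

(** With [V = sqrt (L * T)] the three terms are at most [V], [3 * V] and [2 * V], whence the factor
    6. The other factor absorbs [ln (2 / eta)] into a multiple of [ln (2 * T)]. *)
Lemma regret_sqrt_bound (R : realType) (eta : R) (T N : nat) :
  0 < eta < 1 -> (2 <= T)%N -> (T <= N.*2)%N ->
  let L := log_term 2 T eta in
  1 + 3 * Num.sqrt (L * T%:R) + Num.sqrt (2 * L * T%:R) <=
  6 * Num.sqrt (1 + ln (2 / eta) / ln 2) * Num.sqrt (2 * N%:R * ln (2 * T%:R)).
Proof.
move=> /andP[eta0 eta1] T2 TN /=; set L := log_term _ _ _.
have T2R : 2 <= T%:R :> R by rewrite ler_nat.
have TNR : T%:R <= 2 * N%:R :> R by rewrite -natrM ler_nat mul2n.
(* This follows from [1 - ln 2 <= expR (- ln 2) = 1/2], and yields [1 <= L] below. *)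
have ln2 : 2^-1 <= ln 2 :> R.
  have := expR_ge1Dx (- ln 2 : R).
  by rewrite expRN lnK ?posrE//; lra.
have lneta : 0 <= ln (2 / eta) by rewrite ln_ge0// ler_pdivlMr//; lra.
have lnT : ln 2 + ln 2 <= ln (2 * T%:R) :> R.
  by rewrite -lnM ?posrE// ler_ln ?posrE ?mulr_gt0//; lra.
have LE : L = ln (2 * T%:R) + ln (2 / eta).
  rewrite -lnM ?posrE ?divr_gt0 ?mulr_gt0//; try lra.
  by congr ln; field; rewrite gt_eqF.
have L1 : 1 <= L by rewrite LE; lra.
set c := 1 + ln (2 / eta) / ln 2.
have c1 : 1 <= c by rewrite lerDl divr_ge0//; lra.
have Lc : L <= c * ln (2 * T%:R).
  have : ln (2 / eta) <= ln (2 / eta) / ln 2 * ln (2 * T%:R).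
    by rewrite -mulrA ler_peMr// ler_pdivlMl; lra.
  rewrite LE /c; lra.
set V := Num.sqrt (L * T%:R).
have V1 : 1 <= V by rewrite -sqrtr1 ler_wsqrtr//; nra.
have V2 : Num.sqrt (2 * L * T%:R) <= 2 * V.
  rewrite -[X in X * V](@ger0_norm R)// -sqrtr_sqr -sqrtrM ?sqr_ge0// ler_wsqrtr//.
  nra.
apply: (@le_trans _ _ (6 * V)); first lra.
rewrite -mulrA ler_pM2l// -sqrtrM; last lra.
rewrite ler_wsqrtr// [leRHS]mulrCA [leLHS]mulrC; apply: ler_pM => //; lra.
Qed.

(** At least half of every block is optional, which lets [R] replace [T] in the regret bound. *)
Lemma nonmandatory_alternating (B H aH : nat) : (aH.*2 <= H)%N ->
  (B * H <= (nonmandatory B H (alternating_floor aH)).*2)%N.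
Proof.
move=> aHH; rewrite /nonmandatory -mul2n big_distrr /= -{1}(card_ord B) -sum_nat_const.
apply: leq_sum => b _.
have := @alternating_floor_le H aH b aHH; move: (\sum_j _)%N => S; lia.
Qed.

Lemma measurable_regret_le (R : realType) (B H K : nat) (m : nat -> 'I_K -> nat)
    (mu : 'I_K -> R) (istar : 'I_K) (y : R) (d : measure_display)
    (Omega : measurableType d) (A : Omega -> nat -> 'I_K) :
  (forall t i, measurable [set w | A w t = i]) ->
  measurable [set w | regret B H m mu istar (A w) <= y].
Proof.
move=> mA.
have mmuA t : measurable_fun setT (fun w => mu (A w t)).
  (* There are finitely many arms, so [mu (A w t)] is a finite combination of indicators of
     measurable events. *)
  rewrite (_ : (fun _ => _) =
      (fun w => \sum_i mu i * \1_[set w | A w t = i] w)).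
    by apply: measurable_sum => i; apply: measurable_funM.
  apply/funext => w; rewrite (bigD1 (A w t))//= indicE mem_set// mulr1 big1 ?addr0//.
  by move=> i iA; rewrite indicE memNset ?mulr0//= => Ai; rewrite Ai eqxx in iA.
rewrite (_ : mkset _ = [set w | opt B H m mu istar - y <= \sum_(t < B * H) mu (A w t)]).
  by apply: measurable_ge; exact: measurable_sum.
by apply/seteqP; split => w /=; rewrite /regret; move: (\sum_(t < _) _) => S; lra.
Qed.

(** * Combination of the three claims *)

Theorem proposition34 (R : realType) (eta : R) (heta : 0 < eta < 1) :
  exists2 C : R, 0 < C &
  forall (alpha : R) (B H aH : nat) (Delta : R) (mu : 'I_2 -> R) (istar : 'I_2),
    0 < alpha <= 2^-1 ->
    (0 < B)%N -> ~~ odd B -> (0 < H)%N -> alpha * H%:R = aH%:R ->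
    0 < Delta -> mu arm1 = 1 -> mu arm2 = 1 - Delta -> best_arm mu istar ->
    let m := alternating_floor aH in
    [/\
      (* (i) *)
      (forall G : 'I_2 -> R,
         ~ (forall A : nat -> 'I_2,
              meets_global B H G A <-> meets_blockwise B H m A)) /\
      (exists A : nat -> 'I_2,
         pulls A arm2 0 (B * H) = (\sum_(b < B) m b arm2)%N /\
         forall b, (b < B)%N -> odd_block b ->
           (block_pulls H A b arm2 < m b arm2)%N),
      (* (ii) *)
      forall g2 : R,
        (g2 < alpha ->
           (forall b, (b < B)%N -> odd_block b -> g2 * H%:R < (m b arm2)%:R) /\
           (g2 * H%:R \is a Num.int ->
            exists A : nat -> 'I_2, meets_uniform B H arm2 g2 A /\
              forall b, (b < B)%N -> odd_block b ->
                (block_pulls H A b arm2 < m b arm2)%N)) /\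
        (alpha <= g2 ->
           forall A : nat -> 'I_2, meets_uniform B H arm2 g2 A ->
             alpha * Delta / 2 * (B * H)%:R <= regret B H m mu istar A)
    & (* (iii) *)
      forall (d : measure_display) (Omega : measurableType d)
             (P : probability Omega R) (X : 'I_2 -> nat -> {RV P >-> R})
             (A : Omega -> nat -> 'I_2),
        bandit_rewards mu X ->
        (forall t i, measurable [set w | A w t = i]) ->
        (forall w, bdq_ucb B H m eta (fun i n => X i n w) (A w)) ->
        (forall w, meets_blockwise B H m (A w)) /\
        ((1 - eta)%:E <=
           P [set w | (regret B H m mu istar (A w) <=
                       C * Num.sqrt (2 * (nonmandatory B H m)%:R
                                     * ln (2 * (B * H)%:R)))%R])%E].
Proof.
have /andP[eta0 eta1] := heta.
(* The factor supplied by [regret_sqrt_bound], which depends on [eta] only. *)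
exists (6 * Num.sqrt (1 + ln (2 / eta) / ln 2)).
  rewrite mulr_gt0// sqrtr_gt0 ltr_wpDr// divr_ge0 ?ln_ge0 ?ler1n//.
  by rewrite ler_pdivlMr//; lra.
move=> alpha B H aH D mu istar /andP[alpha0 alpha12] B0 Beven H0 aHE D0 mu1 mu2 best m.
have HR : 0 < H%:R :> R by rewrite ltr0n.
have aH0 : (0 < aH)%N by rewrite -(ltr_nat R) -aHE mulr_gt0.
have aHH : (aH.*2 <= H)%N.
  rewrite -(ler_nat R) -mul2n natrM -aHE mulrA ler_piMl ?ler0n//; lra.
have aHH' : (aH <= H)%N by lia.
have aH0H : (0 < aH <= H)%N by rewrite aH0.
(* The positive gap makes arm 1 the only best arm. *)
have -> : istar = arm1.
  case: (eqVneq istar arm1) => //; rewrite neq_arm1 => /eqP istar2.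
  by exfalso; move: (best arm1); rewrite {}istar2 mu1 mu2; lra.
split.
- by split=> [G|]; [exact: global_floor_insufficient|exact: aggregate_without_blockwise].
- move=> g2; split=> [g2a|g2a A unif].
    have gaH : g2 * H%:R < aH%:R by rewrite -aHE ltr_pM2r.
    split=> [b _ bodd|gint]; first by rewrite /m /alternating_floor bodd eqxx.
    exact: uniform_below_floor.
  have aHg : aH%:R <= g2 * H%:R by rewrite -aHE ler_pM2r.
  have mu21 : mu arm2 <= mu arm1 by lra.
  apply: le_trans (regret_uniform Beven mu21 aHg unif).
  by rewrite mu1 mu2 -aHE natrM; lra.
- move=> d Omega P X A rew mA bdq; split=> [w|].
    apply: (bdq_ucb_meets _ (bdq w)) => b _.
    by have := @alternating_floor_le H aH b aHH; move: (\sum_j _)%N => S; lia.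
  have T0 : (0 < B * H)%N by rewrite muln_gt0 B0.
  (* A positive even [B] is at least 2. *)
  have T2 : (2 <= B * H)%N by case: B B0 Beven {best bdq T0 m} => [|[|B]]//= _ _; lia.
  have [E [mE PE good]] := bdq_ucb_good_event heta T0 rew mu1.
  (* Nonnegativity of this mean comes from the rewards of arm 2 lying in [[0, 1]]. *)
  have mu2_01 : 0 <= mu arm2 < 1.
    have [_ X01 EX] := rew arm2.
    by have /andP[-> _] := expectation_01 (X01 0%N) (EX 0%N); rewrite mu2; lra.
  apply: (le_trans PE); apply: le_measure; rewrite ?inE//.
    exact: measurable_regret_le.
  move=> w /good[x1 x2] /=.
  have L0 : 0 <= log_term 2 (B * H) eta.
    have T1 : 1 <= (B * H)%:R :> R by rewrite ler1n.
    by rewrite ln_ge0// ler_pdivlMr// mul1r; lra.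
  have s0 : 0 <= 3 * Num.sqrt (log_term 2 (B * H) eta * (B * H)%:R).
    by rewrite mulr_ge0// sqrtr_ge0.
  apply: (le_trans (bdq_ucb_regret aHH mu1 mu2_01 s0 L0 x1 x2 (bdq w))).
  exact: (regret_sqrt_bound heta T2 (nonmandatory_alternating B aHH)).
Qed.
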